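(* Let $G$ be a finite group with commutator subgroup $G'=[G,G]$. (1) If there is a prime factor $\pi_1$ of $|G|$ whose multiplicity in the prime factorization of $|G|$ is odd, and $[G:G']$ has a prime factor $\pi_2\neq\pi_1$, then $G$ does not admit a skew-Hadamard difference set. (2) In particular, if $G$ admits a skew-Hadamard difference set, then there is a prime $p\equiv 3\pmod 4$ such that $G/G'$ is a $p$-group and the multiplicity of $p$ in the prime factorization of $|G|$ is odd.
   Context: Let $G$ be a finite group of order $v$. A $(v,k,\lambda)$ difference set in $G$ is a subset $D\subseteq G$ of size $k$ such that each non-identity element of $G$ can be written as $d_1d_2^{-1}$ with $d_1\neq d_2$ in $D$ in exactly $\lambda$ distinct ways. A skew-Hadamard difference set (SHDS) in $G$ is a difference set $D$ such that $G$ is the disjoint union of $D$, $D^{(-1)}$ and $\{1\}$, where $D^{(-1)}=\{d^{-1}: d\in D\}$, and whose parameters are $v=4n-1$, $k=2n-1$, $\lambda=n-1$ for some positive integer $n$ (for nontrivial $G$ this condition on the parameters is automatic; it excludes the trivial group with $D=\emptyset$). We say that $G$ admits an SHDS if such a $D\subseteq G$ exists. *)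

(* Defs.v *)
From mathcomp Require Import all_boot.
From mathcomp Require Import all_fingroup all_solvable.

Set Implicit Arguments.
Unset Strict Implicit.
Unset Printing Implicit Defensive.

Local Open Scope group_scope.

Section DifferenceSets.

Variable gT : finGroupType.
Implicit Types (G : {group gT}) (D : {set gT}).

Definition is_difference_set G (v k lambda : nat) D : Prop :=
  [/\ #|G| = v, D \subset G, #|D| = k
    & forall g, g \in G -> g != 1 ->
        #|[set u : gT * gT | [&& u.1 \in D, u.2 \in D, u.1 != u.2
                               & u.1 * u.2^-1 == g]]| = lambda].

(* D^-1 is the set of inverses of the elements of D. *)
Definition is_SHDS G D : Prop :=
  [/\ exists2 n : nat, (0 < n)%N
        & is_difference_set G (4 * n - 1) (2 * n - 1) (n - 1) D,
      D :|: D^-1 :|: [set 1] = G,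
      [disjoint D & D^-1], [disjoint D & [set 1]] & [disjoint D^-1 & [set 1]]].

Definition admits_SHDS G : Prop := exists D : {set gT}, is_SHDS G D.

End DifferenceSets.

(* Main.v *)
(* Evaluating D at a nontrivial linear character xi of G gives a number S with
   S + S^* = -1 and S S^* = n, so (2 S + 1)^2 = -(4 n - 1) = -|G|.  If xi has
   prime order p, then 2 S + 1 lies in Z[z] for z a primitive p-th root of unity.
   But Q(z) is unramified at every prime q <> p: if B in Z[z] has B^2 = -v with
   q | v, take Q = q^(phi p) = 1 mod p; then q | B^Q and B^Q = B mod q Z[z] by
   Frobenius, so B / q is again in Z[z] and q^2 | v.  Descending, the
   multiplicity of q in v is even.  For part (2), 4 n - 1 = 3 mod 4 has a prime
   factor p = 3 mod 4 of odd multiplicity, and part (1) leaves p as the only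
   possible prime divisor of [G : G']. *)

Require Import Defs.
From mathcomp Require Import all_boot all_order.
From mathcomp Require Import all_fingroup all_solvable.
From mathcomp Require Import all_algebra all_field all_character.
From mathcomp Require Import ring.

Section Arithmetic.
Import Order.TTheory GRing.Theory Num.Theory.
Local Open Scope ring_scope.
Set Implicit Arguments.
Unset Strict Implicit.

(** In characteristic [q], Frobenius is additive, and it fixes every coefficient in ['F_q]. *)
Lemma exp_poly_Fp q j (P : {poly 'F_q}) : prime q ->
  P ^+ (q ^ j) = P \Po 'X^(q ^ j).
Proof.
move=> q_pr; have pnatP : (GRing.pchar {poly 'F_q}).-nat (q ^ j)%N.
  by rewrite pnatX pnatE // pchar_poly pchar_Fp.
elim/poly_ind: P => [|P c IH].
  by rewrite comp_poly0 expr0n expn_eq0 eqn0Ngt prime_gt0.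
rewrite exprDn_pchar // exprMn IH comp_polyD comp_polyM comp_polyX comp_polyC.
rewrite -rmorphXn /=; congr (_ + _%:P).
elim: j {pnatP IH} => [|j IHj]; first by rewrite expr1.
by rewrite expnSr exprM IHj -[in RHS](expf_card c) card_Fp.
Qed.

(** The two polynomials agree after reduction to ['F_q], so [q] divides each coefficient of their
    difference; [R] collects the quotients. *)
Lemma poly_int_congr q j (P : {poly int}) : prime q ->
  exists R : {poly int}, P ^+ (q ^ j) = (P \Po 'X^(q ^ j)) + R *+ q.
Proof.
move=> q_pr; pose f : {rmorphism int -> 'F_q} := intr.
pose E := P ^+ (q ^ j) - (P \Po 'X^(q ^ j)).
have E0 : map_poly f E = 0.
  rewrite /E rmorphB rmorphXn /= map_comp_poly map_polyXn.
  by rewrite exp_poly_Fp ?subrr.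
have dvdE i : (q %| E`_i)%Z.
  have := congr1 (fun p : {poly 'F_q} => p`_i) E0.
  rewrite coef_map coef0 /= /f => /eqP.
  by rewrite -(dvdz_pcharf (pchar_Fp q_pr)).
exists (\poly_(i < size E) (E`_i %/ q)%Z).
apply/eqP; rewrite addrC -subr_eq; apply/eqP/polyP=> i.
rewrite -/E coefMn coef_poly -mulr_natr natz.
case: ltnP => [_|le_i]; first by rewrite divzK.
by rewrite nth_default // mul0r.
Qed.

(** An element of Z[z] is carried by a polynomial [P], which the induction on [v] generalizes
    because the descent replaces B by B / q, the value at [z] of another polynomial. *)
Lemma even_logn_sqr_in_cyclotomic q m v (z : algC) (P : {poly int}) :
    prime q -> coprime q m -> z ^+ m = 1 -> (0 < v)%N ->
    (map_poly intr P).[z] ^+ 2 = - v%:R ->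
  ~~ odd (logn q v).
Proof.
move=> q_pr co_qm zm1.
elim/ltn_ind: v P => v IHv P v_gt0 B2.
have [q_dv|/negPf q_ndv] := boolP (q %| v)%N; last first.
  by rewrite lognE q_ndv !andbF.
have [w Dv] := dvdnP q_dv.
have m_gt0 : (0 < m)%N.
  case: m co_qm {zm1} => // /eqP; rewrite gcdn0 => q1.
  by rewrite q1 in q_pr.
have tot_gt0 : (0 < totient m)%N by rewrite totient_gt0.
have [R DR] := poly_int_congr (totient m) P q_pr.
set Q := (q ^ totient m)%N in DR.
(* Hence [P \Po 'X^Q] and [P] take the same value at [z]. *)
have zQ : z ^+ Q = z.
  have := Euler_exp_totient co_qm; rewrite -/Q => eQ.
  by rewrite -(expr_mod _ zm1) eQ expr_mod.
have Q_gt1 : (2 <= Q)%N by rewrite -(expn0 q) ltn_exp2l ?prime_gt1.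
set B := (map_poly intr P).[z] in B2.
pose h p : algC := (map_poly intr p).[z].
(* From B^2 = -wq one gets B^Q = -wq B^(Q-2), while the congruence gives B^Q = B + q R(z); solving
   for B exhibits the factor q. *)
pose C : {poly int} := - (w%:R *: P ^+ (Q - 2)) - R.
have DB : B = (map_poly intr C).[z] * q%:R.
  have := congr1 h DR; rewrite /h rmorphXn rmorphD /= map_comp_poly map_polyXn.
  rewrite rmorphMn /= hornerD horner_comp hornerXn zQ hornerMn horner_exp -/B.
  rewrite -[in LHS](subnK Q_gt1) exprD B2 Dv => E.
  rewrite rmorphB rmorphN /= linearZ /= hornerD !hornerN hornerZ rmorphXn.
  rewrite /= horner_exp -/B rmorph_nat mulrBl mulr_natr.
  rewrite -[LHS](addrK ((map_poly intr R).[z] *+ q)) -E natrM.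
  congr (_ - _); last by rewrite mulr_natr.
  by rewrite -[RHS]mulr_natr mulrN mulNr mulrA (mulrC w%:R).
set c := (map_poly intr C).[z] in DB.
have q_neq0 : q%:R != 0 :> algC by rewrite pnatr_eq0 -lt0n prime_gt0.
have c2 : c ^+ 2 = - v%:R / (q ^ 2)%:R.
  by rewrite -B2 DB exprMn natrX mulfK // expf_neq0.
(* c^2 = -v / q^2 is rational and an algebraic integer, hence an integer. *)
have q2_dv : (q ^ 2 %| v)%N.
  have c_int : c \in Aint.
    apply: rpred_horner.
      by apply/polyOverP=> i; rewrite coef_map Aint_int.
    by apply: (Aint_unity_root m_gt0); apply/unity_rootP.
  have : c ^+ 2 \in Num.int.
    apply: Cint_rat_Aint; last exact: rpredX.
    by rewrite c2 rpred_div ?rpredN ?rpred_nat.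
  case/intrP=> k Dk; apply/(@dvdzP (q ^ 2)%N v%:Z); exists (- k).
  apply: (@intr_inj algC); rewrite rmorphM rmorphN /= -Dk c2.
  by rewrite mulNr opprK divfK // natrX expf_neq0.
have [u Du] := dvdnP q2_dv.
have u_gt0 : (0 < u)%N by move: v_gt0; rewrite Du muln_gt0 => /andP[].
have lt_uv : (u < v)%N.
  by rewrite Du ltn_Pmulr // -(expn0 q) ltn_exp2l ?prime_gt1.
rewrite Du lognM //; last by rewrite expn_gt0 prime_gt0.
rewrite pfactorK // oddD addbF.
apply: (IHv u lt_uv C) => //.
by rewrite -/c c2 Du natrM mulNr mulfK // natrX expf_neq0.
Qed.

End Arithmetic.

Section Characters.
Import Order.TTheory GRing.Theory Num.Theory.
Local Open Scope ring_scope.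
Set Implicit Arguments.
Unset Strict Implicit.
Variables (gT : finGroupType) (G : {group gT}).

(** Translation by h multiplies the sum by [xi h], so a nonzero sum forces [xi h = 1]. *)
Lemma sum_lin_char_neq1 (xi : 'CF(G)) : xi \is a linear_char -> xi != 1 ->
  \sum_(g in G) xi g = 0.
Proof.
move=> lin_xi; apply: contraNeq => sum_neq0.
apply/eqP/cfun_inP=> h Gh; rewrite cfun1E Gh.
apply: (mulIf sum_neq0); rewrite mul1r mulr_sumr.
rewrite [RHS](reindex_inj (mulgI h)) /=.
apply: eq_big => [g|g Gg]; first by rewrite groupMl.
by rewrite lin_charM.
Qed.

Lemma SHDS_char_sqr (D : {set gT}) (xi : 'CF(G)) :
    is_SHDS G D -> xi \is a linear_char -> xi != 1 ->
  (2 * \sum_(d in D) xi d + 1) ^+ 2 = - #|G|%:R.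
Proof.
case=> [[n n_gt0 [oG sDG oD Dlambda]] defG tiDV tiD1 tiV1] lin_xi xi_neq1.
have G0 := sum_lin_char_neq1 lin_xi xi_neq1.
set S := \sum_(d in D) xi d.
have conjS : \sum_(d in D^-1%g) xi d = S^*.
  rewrite rmorph_sum /= (reindex_inj invg_inj) /=.
  apply: eq_big => [d|d]; first by rewrite inE invgK.
  by rewrite inE invgK => Dd; rewrite lin_charV_conj // (subsetP sDG).
have addS : S + S^* + 1 = 0.
  have sumU (A B : {set gT}) : [disjoint A & B] ->
      \sum_(g in A :|: B) xi g = \sum_(g in A) xi g + \sum_(g in B) xi g.
    by move=> tiAB; rewrite -bigU //; apply: eq_bigl => g; rewrite !inE.
  rewrite -G0 -{1}defG !sumU //; last first.
    by rewrite -setI_eq0 setIUl setU_eq0 !setI_eq0 tiD1.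
  by rewrite conjS big_set1 lin_char1.
(* Group the pairs (d, e) by g = d e^-1. The fibre over 1 has 2n - 1 pairs and the others n - 1; as
   [xi] sums to -1 over g != 1, the total is (2n - 1) - (n - 1) = n. *)
have normS : S * S^* = n%:R.
  rewrite -conjS.
  have -> : \sum_(d in D^-1%g) xi d = \sum_(e in D) xi e^-1%g.
    by rewrite (reindex_inj invg_inj); apply: eq_bigl => d; rewrite inE invgK.
  rewrite mulr_suml.
  under eq_bigr do rewrite mulr_sumr.
  rewrite pair_big /=.
  rewrite (eq_bigr (fun u => xi (u.1 * u.2^-1)%g)); last first.
    by move=> u /andP[D1 D2]; rewrite lin_charM // ?groupV (subsetP sDG).
  rewrite (partition_big (fun u => (u.1 * u.2^-1)%g) (mem G)) /=; last first.
    by move=> u /andP[D1 D2]; rewrite groupM ?groupV ?(subsetP sDG).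
  have fiber g : g \in G ->
    \sum_(u : gT * gT | [&& u.1 \in D & u.2 \in D] && (u.1 * u.2^-1 == g)%g)
       xi (u.1 * u.2^-1)%g = xi g *+ (if g == 1%g then 2 * n - 1 else n - 1)%N.
    move=> Gg; rewrite (eq_bigr (fun _ => xi g)); last first.
      by move=> u /andP[_ /eqP->].
    rewrite sumr_const; congr (_ *+ _); case: eqP => [-> | /eqP g_neq1].
      have inj_diag : injective (fun d : gT => (d, d)) by move=> d e [].
      rewrite -oD -(card_imset _ inj_diag).
      apply: eq_card => -[d e]; rewrite [LHS]unfold_in /=.
      apply/andP/imsetP=> [[/andP[Dd _] /eqP de1]|[c Dc [-> ->]]].
        by exists d; rewrite // -[e]mul1g -de1 mulgKV.
      by rewrite Dc mulgV.
    rewrite -(Dlambda g Gg g_neq1); apply: eq_card => -[d e].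
    rewrite [LHS]unfold_in inE /= -andbA; do 2 congr (_ && _).
    by case: (eqVneq d e) => //= ->; rewrite mulgV eq_sym (negPf g_neq1).
  rewrite (eq_bigr _ fiber) (bigD1 1%g) //= eqxx lin_char1 //.
  under eq_bigr => g /andP[_ /negPf->] do [].
  rewrite sumrMnl.
  have -> : \sum_(g in G | g != 1%g) xi g = - 1.
    by move/eqP: G0; rewrite (bigD1 1%g) //= lin_char1 // addrC addr_eq0 => /eqP.
  rewrite mulNrn -natrB; last by rewrite leq_sub2r // leq_pmull.
  by rewrite subnBA // subnK ?muln_gt0 // mul2n -addnn addnK.
have -> : #|G|%:R = 4 * n%:R - 1 :> algC.
  by rewrite oG natrB ?muln_gt0 // natrM.
(* Both sides become 4 S (S + 1) + 1. *)
rewrite -normS (_ : S^* = - (S + 1)).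
  by ring.
by apply/eqP; rewrite -addr_eq0 addrA (addrC S^*) addS.
Qed.

(** The linear characters form a group of order [G : G'], to which Cauchy's theorem applies. *)
Lemma lin_char_prime_order p : prime p -> (p %| #|G : G^`(1)|%g)%N ->
  exists xi : 'CF(G), [/\ xi \is a linear_char, xi != 1 & xi ^+ p = 1].
Proof.
move=> p_pr; have [L [h [inj_h oL lin_h _] [h1 _ hX _ _]]] := lin_char_group G.
rewrite -oL -cardsT => /Cauchy[] // u _ ou; exists (h u); split=> //.
  by rewrite -h1 (inj_eq inj_h) -order_gt1 ou prime_gt1.
by rewrite -hX -ou expg_order.
Qed.

Lemma SHDS_even_logn p q :
    prime q -> prime p -> (p %| #|G : G^`(1)|%g)%N -> p <> q ->
  admits_SHDS G -> ~~ odd (logn q #|G|).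
Proof.
move=> q_pr p_pr p_dv neq_pq [D sD].
have [xi [lin_xi xi_neq1 xi_p]] := lin_char_prime_order p_pr p_dv.
have [z prim_z] := C_prim_root_exists (prime_gt0 p_pr).
have sDG : D \subset G by case: sD => -[n _ []].
have xiE g : g \in G -> exists i : 'I_p, xi g == z ^+ i.
  move=> Gg; have xig : xi g ^+ p = 1 by rewrite -exp_cfunE // xi_p cfun1E Gg.
  by have [i ->] := prim_rootP prim_z xig; exists i.
(* [e] selects an exponent of [z] giving [xi g]; the default 0 never occurs on [D]. Then [P] below
   has value 2 S + 1 at [z]. *)
pose e (g : gT) : nat :=
  if [pick i : 'I_p | xi g == z ^+ i] is Some i then i else 0%N.
have eP g : g \in D -> xi g = z ^+ e g.
  move=> /(subsetP sDG)/xiE[i xi_i]; rewrite /e.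
  by case: pickP => [j /eqP // | /(_ i)]; rewrite xi_i.
pose P : {poly int} := 2 *: (\sum_(d in D) 'X^(e d)) + 1.
apply: (even_logn_sqr_in_cyclotomic (m := p) (z := z) (P := P)) => //.
- by rewrite prime_coprime // dvdn_prime2 //; apply/eqP=> Dq; case: neq_pq.
- exact: prim_expr_order.
rewrite -(SHDS_char_sqr sD lin_xi xi_neq1); congr (_ ^+ 2).
rewrite rmorphD rmorph1 /= linearZ /= hornerD hornerZ hornerC; congr (_ * _ + _).
rewrite rmorph_sum horner_sum; apply: eq_bigr => d Dd.
by rewrite /= map_polyXn hornerXn eP.
Qed.

End Characters.

(** Otherwise each prime power in [v] is 1 mod 4: its prime is 1 mod 4, or its exponent is even and
    odd squares are 1 mod 4. *)
Lemma ex_prime_3mod4_odd_logn v : v = 3 %[mod 4] ->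
  exists p, [/\ prime p, p = 3 %[mod 4] & odd (logn p v)].
Proof.
move=> v3; have v_gt0 : 0 < v by case: v v3.
have [/hasP[p p_v /andP[/eqP p3 odd_p]]|no_p] :=
    boolP (has (fun p => (p == 3 %[mod 4]) && odd (logn p v)) (primes v)).
  by exists p; split=> //; move: p_v; rewrite mem_primes => /andP[].
suffices: v = 1 %[mod 4] by rewrite v3.
rewrite [in LHS](prod_prime_decomp v_gt0) prime_decompE big_map big_seq /=.
elim/big_ind: _ => // [x y x1 y1|p p_v]; first by rewrite -modnMm x1 y1.
move/hasPn: no_p => /(_ p p_v); rewrite negb_and.
have odd_p : odd p.
  move: p_v; rewrite mem_primes => /and3P[_ _ /dvdnP[w Dv]].
  have: odd v by rewrite (divn_eq v 4) v3 oddD oddM andbF.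
  by rewrite Dv oddM => /andP[].
have p13 : (p == 1 %[mod 4]) || (p == 3 %[mod 4]).
  move: odd_p; rewrite [in odd p](divn_eq p 4) oddD oddM andbF /=.
  by have := ltn_pmod p (isT : 0 < 4); case: (p %% 4) => [|[|[|[]]]].
have sqr1 : p ^ 2 = 1 %[mod 4].
  by rewrite -modnXm; case/orP: p13 => /eqP->.
case/orP=> [p_neq3|even_l].
  move: p13; rewrite (negPf p_neq3) orbF -modnXm => /eqP->.
  by rewrite modnXm exp1n.
rewrite -(odd_double_half (logn p v)) (negPf even_l) add0n -mul2n expnM.
by rewrite -modnXm sqr1 modnXm exp1n.
Qed.

Local Open Scope group_scope.

Theorem corollary2p3 (gT : finGroupType) (G : {group gT}) :
  (forall p1 p2 : nat,
     prime p1 -> p1 %| #|G| -> odd (logn p1 #|G|) ->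
     prime p2 -> p2 %| #|G : G^`(1)| -> p2 <> p1 ->
     ~ admits_SHDS G)
  /\
  (admits_SHDS G ->
   exists p : nat,
     [/\ prime p, p = 3 %[mod 4], p.-group (G / G^`(1))
       & odd (logn p #|G|)]).
Proof.
split=> [q p q_pr _ odd_q p_pr p_dv neq_pq|aG].
  by move/(SHDS_even_logn q_pr p_pr p_dv neq_pq); rewrite odd_q.
have [p [p_pr p3 odd_p]] :
    exists p, [/\ prime p, p = 3 %[mod 4] & odd (logn p #|G|)].
  (* Positivity of n matters: truncated subtraction would turn 4 * 0 - 1 into 0. *)
  apply: ex_prime_3mod4_odd_logn; case: aG => D [[[|n] // _ [-> _ _ _]] _ _ _ _].
  by rewrite mulnS addnC -addnBA // mulnC modnMDl.
exists p; split=> //; apply/pgroupP=> r r_pr.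
rewrite card_quotient ?der_norm // => r_dv.
rewrite inE; apply: contraLR odd_p => /eqP neq_rp.
exact: SHDS_even_logn r_dv neq_rp aG.
Qed.
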